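(* Assume that $g$ and $\psi_{\ell-1}$, $\ell\in[L]$, are directionally differentiable everywhere on $\mathbb{R}^{\bar N_L}$ and $\mathbb{R}^{n+\bar N_{\ell-1}}$, $\ell\in[L]$, respectively, and locally Lipschitz continuous. Then for every $z=(\theta,u)\in\mathcal{F}_0$, $$\mathcal{T}_{\mathcal{F}_0}(z)=\{d=(d_\theta,d_{u_1},\dots,d_{u_L})\in\mathbb{R}^{\bar N}\mid d_{u_\ell}=\psi_{\ell-1}'(\theta,\mathbf{u}_{\ell-1};d_\theta,d_{\mathbf{u}_{\ell-1}}),\ \ell\in[L]\}.$$
   Context: Let $n,L,N_1,\dots,N_L$ be positive integers, $[L]=\{1,\dots,L\}$, $\bar N_0=0$, $\bar N_\ell=\sum_{j=1}^{\ell}N_j$, $\bar N=n+\bar N_L$. Let $g:\mathbb{R}^{\bar N_L}\to[0,\infty)$ and $\psi_{\ell-1}:\mathbb{R}^{n+\bar N_{\ell-1}}\to\mathbb{R}^{N_\ell}$ ($\ell\in[L]$) be continuous functions. Write $u=(u_1,\dots,u_L)$ with $u_\ell\in\mathbb{R}^{N_\ell}$, $\mathbf{u}_\ell=(u_1,\dots,u_\ell)$, $\mathbf{u}_0$ empty (so $\psi_0(\theta,\mathbf{u}_0)=\psi_0(\theta)$), and $z=(\theta,u)\in\mathbb{R}^{\bar N}$ with $\theta\in\mathbb{R}^n$. Directions are split in the same way: $d=(d_\theta,d_u)$, $d_u=(d_{u_1},\dots,d_{u_L})$, $d_{\mathbf{u}_{\ell}}=(d_{u_1},\dots,d_{u_{\ell}})$.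 Feasible set: $\mathcal{F}_0=\{z\in\mathbb{R}^{\bar N}\mid u_\ell=\psi_{\ell-1}(\theta,\mathbf{u}_{\ell-1}),\ \ell\in[L]\}$. Directional derivative: $f'(x;d)=\lim_{\tau\downarrow0}\frac{f(x+\tau d)-f(x)}{\tau}$ (componentwise for vector-valued $f$); $f$ is directionally differentiable at $x$ if this limit exists for all $d$. A function is locally Lipschitz continuous if every point of its domain has a neighborhood on which it is Lipschitz. Tangent cone of $\mathcal{F}\subseteq\mathbb{R}^m$ at $x\in\mathcal{F}$: $\mathcal{T}_{\mathcal{F}}(x)=\{d\in\mathbb{R}^m\mid\exists\,x^k\to x,\ x^k\in\mathcal{F},\ \tau_k\downarrow0\text{ with }(x^k-x)/\tau_k\to d\}$. *)

(* Defs.v *)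
From HB Require Import structures.
From mathcomp Require Import all_boot all_order all_algebra.
From mathcomp Require Import all_classical all_reals all_analysis.
Set Implicit Arguments.
Unset Strict Implicit.
Unset Printing Implicit Defensive.
Import Order.TTheory GRing.Theory Num.Theory.
Import numFieldNormedType.Exports.
Local Open Scope classical_set_scope.
Local Open Scope ring_scope.

(* One-sided, unlike the library's ['D_d f x] and [derivable]. For vector-valued
   [f] the limit is the componentwise one: that is the topology of ['rV_m]. *)
Definition diff_quotient (R : realType) (V W : normedModType R)
    (f : V -> W) (x d : V) (t : R) : W :=
  t^-1 *: (f (x + t *: d) - f x).

Definition dir_derive (R : realType) (V W : normedModType R)
    (f : V -> W) (x d : V) : W :=
  lim (diff_quotient f x d t @[t --> 0^'+]).

Definition dir_differentiable_at (R : realType) (V W : normedModType R)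
    (f : V -> W) (x : V) : Prop :=
  forall d : V, cvg (diff_quotient f x d t @[t --> 0^'+]).

Definition locally_lipschitz (R : realType) (V W : normedModType R)
    (f : V -> W) : Prop :=
  forall x : V, exists2 U : set V, nbhs x U & [lipschitz f y | y in U].

(* [tau_k \downarrow 0] is read as: positive and tending to 0. *)
Definition tangent_cone (R : realType) (V : normedModType R)
    (F : set V) (x : V) : set V :=
  [set d | exists (xs : nat -> V) (tau : nat -> R),
    [/\ xs k @[k --> \oo] --> x,
        forall k, F (xs k),
        forall k, 0 < tau k,
        tau k @[k --> \oo] --> (0 : R) &
        (tau k)^-1 *: (xs k - x) @[k --> \oo] --> d]].

(* A point is (theta, u_0, ..., u_(L-1)) with theta in R^n and the block u_l in
   R^(N l), blocks being numbered from 0; [psi l] gives u_l as a function of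
   (theta, u_0, ..., u_(l-1)). *)
Definition before (L : nat) (l : 'I_L) (j : 'I_l) : 'I_L :=
  widen_ord (ltnW (ltn_ord l)) j.

Definition block (R : realType) (n L : nat) (N : 'I_L -> nat) (l : 'I_L)
    (z : 'rV[R]_(n + \sum_(j < L) N j)) : 'rV[R]_(N l) :=
  submxrow (rsubmx z) l.

Definition prefix_before (R : realType) (n L : nat) (N : 'I_L -> nat) (l : 'I_L)
    (z : 'rV[R]_(n + \sum_(j < L) N j)) :
    'rV[R]_(n + \sum_(j < l) N (before j)) :=
  row_mx (lsubmx z) (\mxrow_(j < l) block (before j) z).

Definition feasible_set (R : realType) (n L : nat) (N : 'I_L -> nat)
    (psi : forall l : 'I_L,
       'rV[R]_(n + \sum_(j < l) N (before j)) -> 'rV[R]_(N l)) :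
    set 'rV[R]_(n + \sum_(j < L) N j) :=
  [set z | forall l : 'I_L, block l z = psi l (prefix_before l z)].

(* Main.v *)
Require Import Defs.
From HB Require Import structures.
From mathcomp Require Import all_boot all_order all_algebra.
From mathcomp Require Import all_classical all_reals all_analysis.
Set Implicit Arguments.
Unset Strict Implicit.
Unset Printing Implicit Defensive.
Import Order.TTheory GRing.Theory Num.Theory.
Import numFieldNormedType.Exports.
Local Open Scope classical_set_scope.
Local Open Scope ring_scope.

(** A feasible point is determined by its parameter theta, because each block
    is a function of theta and of the earlier blocks; the feasible set is
    therefore a graph over the theta-space, and the theorem says that its
    tangent cone is the graph of the directional derivative, computed layer by
    layer.

    The analytic content is [dir_derive_along]: for a locally Lipschitz
    function, the one-sided derivative along the ray x + t d is also the limit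
    of the increments along every curve that leaves x with velocity d. Applied
    to one layer, this is [feasible_block_cvg]: along feasible points
    approaching z, if the scaled increments of (theta, u_0, ..., u_(l-1))
    converge to the corresponding part of d, then those of u_l converge to the
    directional derivative of [psi l].

    A tangent direction d is the limit of the scaled increments of feasible
    points, so its block l equals that derivative by uniqueness of the limit.
    Conversely, if every block of d is that derivative, let x_k be the feasible
    point whose parameter is theta + tau_k d_theta with tau_k = 1/(k+1); it
    exists by [feasible_exists]. The theta-part of (x_k - z)/tau_k is constantly
    d_theta, and induction on the layers gives the convergence of each block to
    the block of d. *)

(** * Directional derivatives along curves *)

(** The point y t is x + tau t *: q t, where the scaled increment q t has a
    limit and tau t tends to 0. *)
Lemma scaled_increment_cvg (R : realType) (V : normedModType R) (T : Type)
    (F : set_system T) {FF : Filter F} (tau : T -> R) (y : T -> V) (x d : V) :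
  tau t @[t --> F] --> (0 : R) ->
  (\forall t \near F, 0 < tau t) ->
  (tau t)^-1 *: (y t - x) @[t --> F] --> d ->
  y t @[t --> F] --> x.
Proof.
move=> tau0 tau_gt0 yd.
have : x + tau t *: ((tau t)^-1 *: (y t - x)) @[t --> F] --> x + 0 *: d.
  by apply: cvgD; [exact: cvg_cst|exact: cvgZ].
rewrite scale0r addr0; apply: cvg_trans; apply: near_eq_cvg.
apply: filterS tau_gt0 => t t_gt0.
by rewrite scalerA divff ?gt_eqF// scale1r addrC subrK.
Qed.

(** The increment of f along y differs from the one along the ray x + tau t *: d
    by f (y t) - f (x + tau t *: d). Near x, f is M-Lipschitz, so after division
    by tau t this error is at most M times the distance from the scaled
    increment of y to d, which tends to 0. In the terminology of nonsmooth
    analysis, a locally Lipschitz directionally differentiable function is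
    Hadamard directionally differentiable. *)
Lemma dir_derive_along (R : realType) (V W : normedModType R) (f : V -> W)
    (T : Type) (F : set_system T) {FF : Filter F} (tau : T -> R) (y : T -> V)
    (x d : V) :
  locally_lipschitz f -> dir_differentiable_at f x ->
  tau t @[t --> F] --> (0 : R) ->
  (\forall t \near F, 0 < tau t) ->
  (tau t)^-1 *: (y t - x) @[t --> F] --> d ->
  (tau t)^-1 *: (f (y t) - f x) @[t --> F] --> dir_derive f x d.
Proof.
move=> lipf df tau0 tau_gt0 yd.
have yx := scaled_increment_cvg tau0 tau_gt0 yd.
have rayx : x + tau t *: d @[t --> F] --> x.
  rewrite -[X in _ --> X]addr0 -[X in _ --> _ + X](scale0r d).
  by apply: cvgD; [exact: cvg_cst|apply: cvgZ => //; exact: cvg_cst].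
have tau0r : tau t @[t --> F] --> (0 : R)^'+.
  move=> A A0; rewrite /= nbhs_filterE.
  have := tau0 _ A0; rewrite /= nbhs_filterE => near_A.
  by apply: filterS2 near_A tau_gt0 => t /=; apply.
have ray : diff_quotient f x d (tau t) @[t --> F] --> dir_derive f x d.
  apply: (cvg_comp _ (diff_quotient f x d) tau0r); exact: df.
have [U Ux lipU] := lipf x.
have [M M_gt0 lipM] := pinfty_ex_gt0 lipU.
have gap : (tau t)^-1 *: (f (y t) - f (x + tau t *: d)) @[t --> F] --> (0 : W).
  apply/norm_cvg0P.
  have yd0 : M * `|(tau t)^-1 *: (y t - x) - d| @[t --> F] --> (0 : R).
    rewrite -[X in _ --> X](mulr0 M); apply: cvgM; first exact: cvg_cst.
    apply/norm_cvg0P; rewrite -[X in _ --> X](subrr d).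
    by apply: cvgB => //; exact: cvg_cst.
  apply: (squeeze_cvgr _ (cvg_cst 0) yd0).
  near=> t.
  have t_gt0 : 0 < tau t by near: t.
  rewrite normr_ge0 /= normrZ gtr0_norm ?invr_gt0//.
  have -> : (tau t)^-1 *: (y t - x) - d =
            (tau t)^-1 *: (y t - (x + tau t *: d)).
    by rewrite opprD addrA [in RHS]scalerBr scalerA mulVf ?gt_eqF// scale1r.
  rewrite normrZ gtr0_norm ?invr_gt0// mulrCA ler_pM2l ?invr_gt0//.
  apply: (lipM (y t, x + tau t *: d)); split => /=.
    by near: t; exact: yx.
  by near: t; exact: rayx.
rewrite -[dir_derive f x d]add0r.
rewrite (_ : (fun t => _) = (fun t =>
  (tau t)^-1 *: (f (y t) - f (x + tau t *: d)) + diff_quotient f x d (tau t))).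
  exact: cvgD.
by apply/funext => t; rewrite /diff_quotient -scalerDr addrA subrK.
Unshelve. all: by end_near. Qed.

(** * Blocks of row vectors *)

Lemma mx_cvg (R : realType) (m n : nat) (T : Type) (F : set_system T)
    {FF : Filter F} (A : T -> 'M[R]_(m, n)) (a : 'M[R]_(m, n)) :
  (forall i j, A t i j @[t --> F] --> a i j) -> A t @[t --> F] --> a.
Proof.
move=> Aa B [P aP PB]; rewrite /= nbhs_filterE.
apply: filterS (PB) _; apply: filter_forall => i; apply: filter_forall => j.
exact: Aa (aP i j).
Qed.

Lemma row_mx_cvg (R : realType) (m n1 n2 : nat) (T : Type) (F : set_system T)
    {FF : Filter F} (A : T -> 'M[R]_(m, n1)) (B : T -> 'M[R]_(m, n2))
    (a : 'M[R]_(m, n1)) (b : 'M[R]_(m, n2)) :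
  A t @[t --> F] --> a -> B t @[t --> F] --> b ->
  row_mx (A t) (B t) @[t --> F] --> row_mx a b.
Proof.
move=> Aa Bb; apply: mx_cvg => i j; rewrite mxE.
under eq_fun do rewrite mxE.
case: (fintype.split j) => k.
  exact: (cvg_comp _ _ Aa (@coord_continuous R m n1 i k a)).
exact: (cvg_comp _ _ Bb (@coord_continuous R m n2 i k b)).
Qed.

Lemma mxrow_cvg (R : realType) (m q : nat) (q_ : 'I_q -> nat) (T : Type)
    (F : set_system T) {FF : Filter F}
    (A : T -> forall j, 'M[R]_(m, q_ j)) (a : forall j, 'M[R]_(m, q_ j)) :
  (forall j, A t j @[t --> F] --> a j) ->
  \mxrow_j A t j @[t --> F] --> \mxrow_j a j.
Proof.
move=> Aa; apply: mx_cvg => i j; rewrite mxE.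
under eq_fun do rewrite mxE.
exact: (cvg_comp _ _ (Aa _) (@coord_continuous R m _ i _ (a _))).
Qed.

Lemma block_cvg (R : realType) (n L : nat) (N : 'I_L -> nat) (l : 'I_L)
    (T : Type) (F : set_system T) {FF : Filter F}
    (z : T -> 'rV[R]_(n + \sum_(j < L) N j))
    (d : 'rV[R]_(n + \sum_(j < L) N j)) :
  z t @[t --> F] --> d -> block l (z t) @[t --> F] --> block l d.
Proof.
move=> zd; apply: mx_cvg => i j; rewrite !mxE.
under eq_fun do rewrite !mxE.
exact: (cvg_comp _ _ zd (@coord_continuous R 1 _ i _ d)).
Qed.

(** Only the blocks preceding l are required to converge; this is what allows
    the convergence of the blocks to be proved by induction on l. *)
Lemma prefix_before_cvg (R : realType) (n L : nat) (N : 'I_L -> nat)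
    (l : 'I_L) (T : Type) (F : set_system T) {FF : Filter F}
    (z : T -> 'rV[R]_(n + \sum_(j < L) N j))
    (d : 'rV[R]_(n + \sum_(j < L) N j)) :
  lsubmx (z t) @[t --> F] --> lsubmx d ->
  (forall j : 'I_L, (j < l)%N -> block j (z t) @[t --> F] --> block j d) ->
  prefix_before l (z t) @[t --> F] --> prefix_before l d.
Proof.
move=> zd bzd; apply: row_mx_cvg => //; apply: mxrow_cvg => j.
exact: (bzd (before j) (ltn_ord j)).
Qed.

Lemma row_cvg_blocks (R : realType) (n L : nat) (N : 'I_L -> nat)
    (T : Type) (F : set_system T) {FF : Filter F}
    (z : T -> 'rV[R]_(n + \sum_(j < L) N j))
    (d : 'rV[R]_(n + \sum_(j < L) N j)) :
  lsubmx (z t) @[t --> F] --> lsubmx d ->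
  (forall j : 'I_L, block j (z t) @[t --> F] --> block j d) ->
  z t @[t --> F] --> d.
Proof.
move=> zd bzd.
have splitE (x : 'rV[R]_(n + \sum_(j < L) N j)) :
    x = row_mx (lsubmx x) (\mxrow_j block j x).
  by rewrite /block submxrowK hsubmxK.
rewrite (splitE d).
have -> : z = fun t => row_mx (lsubmx (z t)) (\mxrow_j block j (z t)).
  by apply/funext => t; exact: splitE.
by apply: row_mx_cvg => //; exact: mxrow_cvg.
Qed.

Lemma block_scaled_increment (R : realType) (n L : nat) (N : 'I_L -> nat)
    (l : 'I_L) (a : R) (x y : 'rV[R]_(n + \sum_(j < L) N j)) :
  block l (a *: (x - y)) = a *: (block l x - block l y).
Proof. by apply/matrixP => i j; rewrite !mxE. Qed.

Lemma prefix_scaled_increment (R : realType) (n L : nat) (N : 'I_L -> nat)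
    (l : 'I_L) (a : R) (x y : 'rV[R]_(n + \sum_(j < L) N j)) :
  prefix_before l (a *: (x - y)) =
  a *: (prefix_before l x - prefix_before l y).
Proof.
by apply/matrixP => i j; rewrite !mxE; case: (fintype.split j) => k; rewrite !mxE.
Qed.

(** * Feasible points *)

Lemma eq_prefix_before (R : realType) (n L : nat) (N : 'I_L -> nat)
    (l : 'I_L) (x y : 'rV[R]_(n + \sum_(j < L) N j)) :
  lsubmx x = lsubmx y ->
  (forall j : 'I_L, (j < l)%N -> block j x = block j y) ->
  prefix_before l x = prefix_before l y.
Proof.
move=> xy bxy; rewrite /prefix_before xy; congr row_mx.
by apply: eq_mxrow => j; exact: (bxy (before j) (ltn_ord j)).
Qed.

Definition layer_update (R : realType) (n L : nat) (N : 'I_L -> nat)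
    (psi : forall l : 'I_L,
       'rV[R]_(n + \sum_(j < l) N (before j)) -> 'rV[R]_(N l))
    (theta : 'rV[R]_n) (z : 'rV[R]_(n + \sum_(j < L) N j)) :
    'rV[R]_(n + \sum_(j < L) N j) :=
  row_mx theta (\mxrow_(l < L) psi l (prefix_before l z)).

(** One [layer_update] recomputes every block from the current earlier ones. The
    blocks before m no longer change after m updates, since each depends only on
    blocks that have stabilised before it; after L updates the point is a fixed
    point of [layer_update], which is what feasibility means. *)
Lemma feasible_exists (R : realType) (n L : nat) (N : 'I_L -> nat)
    (psi : forall l : 'I_L,
       'rV[R]_(n + \sum_(j < l) N (before j)) -> 'rV[R]_(N l))
    (theta : 'rV[R]_n) :
  exists2 z, feasible_set psi z & lsubmx z = theta.
Proof.
pose T := layer_update psi theta.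
pose z m := iter m T (row_mx theta 0).
have lz m : lsubmx (z m) = theta by case: m => [|m]; rewrite /= row_mxKl.
have bz m l : block l (z m.+1) = psi l (prefix_before l (z m)).
  by rewrite /block /= row_mxKr mxrowK.
have stable m : forall l : 'I_L, (l < m)%N -> block l (z m.+1) = block l (z m).
  elim: m => // m IH l lm; rewrite !bz; congr (psi l _).
  apply: eq_prefix_before; first by rewrite !lz.
  by move=> j jl; apply: IH; exact: leq_trans jl lm.
exists (z L); last exact: lz.
by move=> l; rewrite -stable// bz.
Qed.

(** Both inclusions rest on this step. On feasible points block l is the value
    of [psi l] at the prefix, so its scaled increment is that of [psi l] along
    the curve of prefixes, whose velocity is the prefix of d. *)
Lemma feasible_block_cvg (R : realType) (n L : nat) (N : 'I_L -> nat)
    (psi : forall l : 'I_L,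
       'rV[R]_(n + \sum_(j < l) N (before j)) -> 'rV[R]_(N l))
    (l : 'I_L) (T : Type) (F : set_system T) {FF : Filter F} (tau : T -> R)
    (x : T -> 'rV[R]_(n + \sum_(j < L) N j))
    (z d : 'rV[R]_(n + \sum_(j < L) N j)) :
  locally_lipschitz (psi l) ->
  dir_differentiable_at (psi l) (prefix_before l z) ->
  feasible_set psi z -> (forall t, feasible_set psi (x t)) ->
  tau t @[t --> F] --> (0 : R) -> (\forall t \near F, 0 < tau t) ->
  prefix_before l ((tau t)^-1 *: (x t - z)) @[t --> F] -->
    prefix_before l d ->
  block l ((tau t)^-1 *: (x t - z)) @[t --> F] -->
    dir_derive (psi l) (prefix_before l z) (prefix_before l d).
Proof.
move=> lip_l diff_l zF xF tau0 tau_gt0 prefix_d.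
under eq_fun => t do rewrite block_scaled_increment (xF t) (zF l).
apply: (dir_derive_along lip_l diff_l tau0 tau_gt0).
have <- : (fun t => prefix_before l ((tau t)^-1 *: (x t - z))) =
    (fun t => (tau t)^-1 *: (prefix_before l (x t) - prefix_before l z)).
  by apply/funext => t; exact: prefix_scaled_increment.
exact: prefix_d.
Qed.

Theorem theorem3p1 (R : realType) (n L : nat) (N : 'I_L -> nat)
    (n_gt0 : (0 < n)%N) (L_gt0 : (0 < L)%N) (N_gt0 : forall l, (0 < N l)%N)
    (g : 'rV[R]_(\sum_(j < L) N j) -> R)
    (psi : forall l : 'I_L,
       'rV[R]_(n + \sum_(j < l) N (before j)) -> 'rV[R]_(N l))
    (g_ge0 : forall u, 0 <= g u)
    (g_cont : continuous g)
    (psi_cont : forall l, continuous (psi l))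
    (g_dirdiff : forall u, dir_differentiable_at g u)
    (psi_dirdiff : forall l v, dir_differentiable_at (psi l) v)
    (g_lip : locally_lipschitz g)
    (psi_lip : forall l, locally_lipschitz (psi l)) :
  forall z : 'rV[R]_(n + \sum_(j < L) N j), feasible_set psi z ->
    tangent_cone (feasible_set psi) z =
    [set d | forall l : 'I_L,
       block l d =
       dir_derive (psi l) (prefix_before l z) (prefix_before l d)].
Proof.
move=> z zF; apply/seteqP; split=> [d|d dE].
  move=> [xs [tau [_ xsF tau_gt0 tau0 xs_d]]] l.
  apply: (cvg_unique _ (block_cvg (l := l) xs_d)) => //.
  apply: feasible_block_cvg => //; first exact: nearW.
  apply: prefix_before_cvg => [|j _]; last exact: block_cvg.
  exact: (cvg_comp _ _ xs_d (@continuous_lsubmx R 1 n _ d)).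
pose tau : nat -> R := harmonic.
have tau_gt0 k : 0 < tau k by exact: harmonic_gt0.
have tau_near : \forall k \near \oo, 0 < tau k by exact: nearW.
have tau0 : tau k @[k --> \oo] --> (0 : R) by exact: cvg_harmonic.
have /choice[xs xsP] k : exists x,
    feasible_set psi x /\ lsubmx x = lsubmx z + tau k *: lsubmx d.
  by have [x] := feasible_exists psi (lsubmx z + tau k *: lsubmx d); exists x.
have theta_d : lsubmx ((tau k)^-1 *: (xs k - z)) @[k --> \oo] --> lsubmx d.
  under eq_fun => k.
    rewrite linearZ linearB /= (xsP k).2 addrC addKr scalerA.
    rewrite mulVf ?gt_eqF// scale1r.
    over.
  exact: cvg_cst.
(* Feasibility of x_k makes block l follow the earlier blocks, and [dE]
   identifies the limit with block l of d. *)
have layers_d m : forall l : 'I_L, (l < m)%N ->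
    block l ((tau k)^-1 *: (xs k - z)) @[k --> \oo] --> block l d.
  elim: m => // m IH l lm.
  rewrite dE; apply: feasible_block_cvg => // [k|]; first exact: (xsP k).1.
  by apply: prefix_before_cvg => // j jl; apply: IH; exact: leq_trans jl lm.
have xs_d : (tau k)^-1 *: (xs k - z) @[k --> \oo] --> d.
  by apply: row_cvg_blocks => // l; exact: layers_d (ltn_ord l).
exists xs, tau; split => //; last by move=> k; exact: (xsP k).1.
exact: scaled_increment_cvg tau0 tau_near xs_d.
Qed.
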